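(* Let $p\ge q>0$, and let $(a_n)_{n\ge1}$ and $(\lambda_n)_{n\ge1}$ be sequences of real numbers with $a_n\ge0$ and $\lambda_n>0$ for all $n\ge 1$. Define $\Lambda_n=\sum_{i=1}^n\lambda_i$ and $A_n=\sum_{i=1}^n\lambda_i a_i$. Then $$\sum_{n=1}^\infty\lambda_n\left(\frac{A_n}{\Lambda_n}\right)^{-p}\le\left(\frac{p+1}{p}\right)^q\sum_{n=1}^\infty\lambda_n\left(\frac{A_n}{\Lambda_n}\right)^{-p+q}a_n^{-q}.$$
   Context: Series of terms in $[0,+\infty]$ take values in $[0,+\infty]$, and the inequality is understood in $[0,+\infty]$. Conventions: $0^{-r}=+\infty$ for $r>0$, $0^0=1$, and $(+\infty)\cdot c=+\infty$ for $c\in(0,+\infty]$. *)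

(* Defs.v *)
From HB Require Import structures.
From mathcomp Require Import all_boot all_order all_algebra.
From mathcomp Require Import all_classical all_reals all_analysis.

Set Implicit Arguments.
Unset Strict Implicit.
Unset Printing Implicit Defensive.

Import Order.TTheory GRing.Theory Num.Theory.
Local Open Scope ring_scope.

(* Real power of x >= 0 with value in [0, +oo]. [powR] gives 0 `^ r = 0 for
   every r != 0 (and 0 `^ 0 = 1), so 0 to a negative power must be set to +oo
   explicitly. *)
Definition epow (R : realType) (x r : R) : \bar R :=
  if (x == 0) && (r < 0) then +oo%E else (x `^ r)%:E.

(* Sequences are indexed by n >= 1; the value at 0 is never used. *)
Definition Lam (R : realType) (lambda : nat -> R) (n : nat) : R :=
  \sum_(1 <= i < n.+1) lambda i.

Definition wsum (R : realType) (lambda a : nat -> R) (n : nat) : R :=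
  \sum_(1 <= i < n.+1) lambda i * a i.

(* Main.v *)
Require Import Defs.
From mathcomp Require Import all_boot all_order all_algebra.
From mathcomp Require Import all_classical all_reals all_analysis.
From mathcomp Require Import ring lra.

Import Order.TTheory GRing.Theory Num.Theory.
Local Open Scope ring_scope.

(** Write [x_n = A_n / Lambda_n] and [C = (p + 1) / p]. If some [a_n] vanishes,
    the [n]-th term on the right is [+oo]: either [x_n > 0] and only [a_n ^ -q]
    is infinite, or [x_n = 0] and [x_n ^ (-p + q)] is [+oo] or [1] because
    [q <= p]. So all [a_n] may be taken positive, and every term is then finite.

    The only analytic input is that the graph of [t |-> t ^ -r] lies above its
    tangents ([powRN_above_tangent]). It is used twice in [hardy_step].
    - The tangent at [x_n], evaluated at [x_(n-1)] with exponent [p], combined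
      with [lambda_n a_n = Lambda_n x_n - Lambda_(n-1) x_(n-1)], gives
        [lambda_n x_n^(-p-1) a_n <= C lambda_n x_n^-p - (D_n - D_(n-1)) / p]
      where [D_n = Lambda_n x_n^-p].
    - The tangent at [C x_n], evaluated at [a_n] with exponent [q], gives
        [C^q lambda_n x_n^(-p+q) a_n^-q
           >= (1 + q) lambda_n x_n^-p - (q / C) lambda_n x_n^(-p-1) a_n].
      This takes the place of the Hölder inequality for the whole sums. The base
      point is [C x_n] because the [n]-th terms of the two sides of the theorem
      agree when [a_n = C x_n].
    Eliminating [lambda_n x_n^(-p-1) a_n] leaves the [n]-th term of the desired
    inequality plus the difference [(q / (p + 1)) (D_n - D_(n-1))]. These
    differences telescope to a nonnegative quantity, so the inequality holds for
    partial sums ([hardy_partial_sum]), hence for the series. *)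

(** The tangent to [t |-> t ^ -r] at [x], read at [y]; by homogeneity it is
    [s ^ -r >= 1 + r - r s] for [s = y / x], and this follows from
    [s ^ -r = exp (- r ln s) >= 1 - r ln s] and [ln s <= s - 1]. *)
Lemma powRN_above_tangent (R : realType) (r x y : R) :
  0 <= r -> 0 < x -> 0 < y ->
  x `^ (- r) * (1 + r - r * (y / x)) <= y `^ (- r).
Proof.
move=> r0 x0 y0; set s := y / x.
have s0 : 0 < s by rewrite divr_gt0.
have -> : y = x * s by rewrite /s mulrC divfK // gt_eqF.
rewrite (powRM _ (ltW x0) (ltW s0)) ler_pM2l ?powR_gt0 //.
have lns : ln s <= s - 1.
  have -> : s = 1 + (s - 1) by ring.
  by rewrite (_ : 1 + (s - 1) - 1 = s - 1); [apply: le_ln1Dx; lra | ring].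
rewrite /powR gt_eqF //; apply: le_trans (expR_ge1Dx _).
have := ler_wpM2l r0 lns; lra.
Qed.

(** One summand of the inequality, with the telescoping difference. Here
    [L], [v] are [Lambda_(n-1)], [x_(n-1)] and [w], [u], [a] are [lambda_n],
    [x_n], [a_n]; at [n = 1] one has [L = 0] and [v] is meaningless, hence the
    disjunction. *)
Lemma hardy_step (R : realType) (p q L w u v a : R) :
  0 < p -> 0 < q -> 0 <= L -> 0 < w -> 0 < u -> 0 < a ->
  (L = 0) \/ (0 < v) -> w * a = (L + w) * u - L * v ->
  w * u `^ (- p) + q / (p + 1) * ((L + w) * u `^ (- p) - L * v `^ (- p))
  <= ((p + 1) / p) `^ q * (w * u `^ (- p + q) * a `^ (- q)).
Proof.
move=> p0 q0 L0 w0 u0 a0 Lv wa.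
have p10 : 0 < p + 1 by lra.
have C0 : 0 < (p + 1) / p by rewrite divr_gt0.
have previous : L * (u `^ (- p) * (1 + p - p * (v / u))) <= L * v `^ (- p).
  case: Lv => [->|v0]; first by rewrite !mul0r.
  by rewrite ler_wpM2l // powRN_above_tangent // ltW.
have current : w * u `^ (- p) * (1 + q - q * (a / ((p + 1) / p * u)))
    <= ((p + 1) / p) `^ q * (w * u `^ (- p + q) * a `^ (- q)).
  rewrite [leRHS]mulrA; have Cu0 : 0 < (p + 1) / p * u by exact: mulr_gt0.
  have := powRN_above_tangent _ q _ _ (ltW q0) Cu0 a0.
  have K0 : 0 <= ((p + 1) / p) `^ q * (w * u `^ (- p + q)).
    by rewrite !mulr_ge0 ?powR_ge0 ?(ltW w0).
  move=> /(ler_wpM2l K0); apply: le_trans.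
  rewrite (powRM _ (ltW C0) (ltW u0)) powRD ?(gt_eqF u0) ?implybT // !powRN.
  rewrite le_eqVlt; apply/orP; left; apply/eqP; field.
  by rewrite !gt_eqF ?powR_gt0 //; lra.
apply: le_trans current.
have k0 : 0 <= q / (p + 1) by rewrite divr_ge0 // ltW.
(* The weight [q / (p + 1)] makes the terms in [v / u] cancel against those in
   [a]: the remaining difference is exactly the slack in [previous]. *)
have /(ler_wpM2l k0) := previous.
set P := u `^ (- p); set V := v `^ (- p) => previous'.
rewrite -subr_ge0 in previous'; rewrite -subr_ge0.
apply: le_trans previous' _; rewrite le_eqVlt; apply/orP; left; apply/eqP.
have -> : a = ((L + w) * u - L * v) / w.
  by rewrite -wa mulrAC divff ?mul1r // gt_eqF.
by field; rewrite !gt_eqF.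
Qed.

Local Notation mean lambda a n := (wsum lambda a n / Lam lambda n).

Lemma LamS (R : realType) (lambda : nat -> R) n :
  Lam lambda n.+1 = Lam lambda n + lambda n.+1.
Proof. by rewrite /Lam big_nat_recr. Qed.

Lemma wsumS (R : realType) (lambda a : nat -> R) n :
  wsum lambda a n.+1 = wsum lambda a n + lambda n.+1 * a n.+1.
Proof. by rewrite /wsum big_nat_recr. Qed.

Lemma Lam_ge0 (R : realType) (lambda : nat -> R) n
    (hlambda : forall n : nat, (1 <= n)%N -> 0 < lambda n) :
  0 <= Lam lambda n.
Proof.
rewrite /Lam big_nat_cond sumr_ge0 // => i /andP[/andP[i1 _] _].
by rewrite ltW ?hlambda.
Qed.

Lemma LamS_gt0 (R : realType) (lambda : nat -> R) n
    (hlambda : forall n : nat, (1 <= n)%N -> 0 < lambda n) :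
  0 < Lam lambda n.+1.
Proof. by rewrite LamS ltr_wpDl ?Lam_ge0 ?hlambda. Qed.

Lemma wsum_ge0 (R : realType) (lambda a : nat -> R) n
    (hlambda : forall n : nat, (1 <= n)%N -> 0 < lambda n)
    (a_ge0 : forall n : nat, (1 <= n)%N -> 0 <= a n) :
  0 <= wsum lambda a n.
Proof.
rewrite /wsum big_nat_cond sumr_ge0 // => i /andP[/andP[i1 _] _].
by rewrite mulr_ge0 ?a_ge0 // ltW ?hlambda.
Qed.

Lemma meanS_gt0 (R : realType) (lambda a : nat -> R) n
    (hlambda : forall n : nat, (1 <= n)%N -> 0 < lambda n)
    (a_gt0 : forall n : nat, (1 <= n)%N -> 0 < a n) :
  0 < mean lambda a n.+1.
Proof.
apply: divr_gt0; last exact: LamS_gt0.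
rewrite wsumS ltr_wpDl ?mulr_gt0 ?hlambda ?a_gt0 //.
by rewrite wsum_ge0 // => m m1; rewrite ltW ?a_gt0.
Qed.

(** The second summand on the left is the sum of the telescoping differences of
    [hardy_step]; the induction needs it in the statement. *)
Lemma hardy_partial_sum (R : realType) (lambda a : nat -> R) (p q : R) N
    (hlambda : forall n : nat, (1 <= n)%N -> 0 < lambda n)
    (a_gt0 : forall n : nat, (1 <= n)%N -> 0 < a n) :
  0 < p -> 0 < q ->
  \sum_(1 <= n < N.+1) lambda n * mean lambda a n `^ (- p)
    + q / (p + 1) * (Lam lambda N * mean lambda a N `^ (- p))
  <= ((p + 1) / p) `^ q *
     \sum_(1 <= n < N.+1)
        lambda n * mean lambda a n `^ (- p + q) * a n `^ (- q).
Proof.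
move=> p0 q0; elim: N => [|N IH].
  by rewrite /Lam !big_nil !(mul0r, mulr0, add0r).
rewrite [in leLHS]big_nat_recr // [in leRHS]big_nat_recr //=.
have xN : (Lam lambda N = 0) \/ (0 < mean lambda a N).
  by case: N {IH} => [|N]; [left; rewrite /Lam big_nil | right; exact: meanS_gt0].
have recur : lambda N.+1 * a N.+1
    = (Lam lambda N + lambda N.+1) * mean lambda a N.+1
      - Lam lambda N * mean lambda a N.
  have LxE n : Lam lambda n * mean lambda a n = wsum lambda a n.
    case: n => [|n]; first by rewrite /Lam /wsum !big_nil mul0r.
    by rewrite mulrC divfK // gt_eqF ?LamS_gt0.
  by rewrite -LamS !LxE wsumS; ring.
have := hardy_step _ p q _ _ _ _ _ p0 q0 (Lam_ge0 _ _ N hlambda)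
  (hlambda N.+1 isT) (meanS_gt0 _ _ _ N hlambda a_gt0) (a_gt0 N.+1 isT)
  xN recur.
rewrite -LamS mulrDr; lra.
Qed.

Lemma epow_ge0 (R : realType) (x r : R) : (0 <= epow x r)%E.
Proof. by rewrite /epow; case: ifP => // _; rewrite lee_fin powR_ge0. Qed.

Lemma epow_gt0E (R : realType) (x r : R) : 0 < x -> epow x r = (x `^ r)%:E.
Proof. by move=> x0; rewrite /epow gt_eqF. Qed.

Lemma epow_gt0 (R : realType) (x r : R) : 0 <= x -> r <= 0 -> (0 < epow x r)%E.
Proof.
move=> x0 r0; rewrite /epow; case: ifPn => [_|]; first by rewrite ltry.
rewrite negb_and -leNgt => /orP[xn0|r0'].
  by rewrite lte_fin powR_gt0 // lt_neqAle eq_sym xn0.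
by rewrite (_ : r = 0) ?powRr0 ?lte_fin //; apply/eqP; rewrite eq_le r0.
Qed.

Lemma nneseries_ge_term (R : realType) (u : nat -> \bar R) (m k : nat) :
  (forall n, (m <= n)%N -> (0 <= u n)%E) -> (m <= k)%N ->
  (u k <= \sum_(m <= n <oo) u n)%E.
Proof.
move=> u0 mk; apply: le_trans (nneseries_lim_ge k.+1 _); last by move=> n /u0.
rewrite big_nat_recr //= leeDr // big_nat_cond.
by apply: sume_ge0 => n /andP[/andP[/u0]].
Qed.

Theorem theorem2 (R : realType) (p q : R) (a lambda : nat -> R)
    (hq : 0 < q) (hpq : q <= p)
    (ha : forall n : nat, (1 <= n)%N -> 0 <= a n)
    (hlambda : forall n : nat, (1 <= n)%N -> 0 < lambda n) :
  (\sum_(1 <= n <oo)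
      (lambda n)%:E * epow (wsum lambda a n / Lam lambda n) (- p)
   <= (((p + 1) / p) `^ q)%:E *
      \sum_(1 <= n <oo)
        ((lambda n)%:E * epow (wsum lambda a n / Lam lambda n) (- p + q)
         * epow (a n) (- q)))%E.
Proof.
have p0 : 0 < p by exact: lt_le_trans hpq.
have C0 : 0 < ((p + 1) / p) `^ q by rewrite powR_gt0 // divr_gt0 //; lra.
have lhs_ge0 n : (1 <= n)%N ->
    (0 <= (lambda n)%:E * epow (wsum lambda a n / Lam lambda n) (- p))%E.
  by move=> n1; rewrite mule_ge0 ?epow_ge0 // lee_fin ltW ?hlambda.
have rhs_ge0 n : (1 <= n)%N ->
    (0 <= (lambda n)%:E * epow (wsum lambda a n / Lam lambda n) (- p + q)
          * epow (a n) (- q))%E.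
  by move=> n1; rewrite !mule_ge0 ?epow_ge0 // lee_fin ltW ?hlambda.
have [[k [k1 ak0]]|a_neq0] := pselect (exists k, (1 <= k)%N /\ a k = 0).
  suff -> : (\sum_(1 <= n <oo)
        ((lambda n)%:E * epow (wsum lambda a n / Lam lambda n) (- p + q)
         * epow (a n) (- q)) = +oo)%E by rewrite gt0_muley ?lte_fin // leey.
  apply/eqP; rewrite -leye_eq.
  apply: le_trans (nneseries_ge_term _ _ _ _ rhs_ge0 k1).
  rewrite ak0 [epow 0 _]/epow eqxx oppr_lt0 hq /= gt0_muley //.
  rewrite mule_gt0 ?lte_fin ?hlambda // epow_gt0 //; last by lra.
  by rewrite divr_ge0 ?wsum_ge0 ?Lam_ge0.
have a_gt0 n : (1 <= n)%N -> 0 < a n.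
  move=> n1; rewrite lt_neqAle ha // andbT eq_sym; apply/eqP => an0.
  by apply: a_neq0; exists n.
apply: lime_le; first by apply: is_cvg_nneseries => n n1 _; exact: lhs_ge0.
apply: nearW => -[|N].
  rewrite big_geq // mule_ge0 ?lee_fin ?(ltW C0) //.
  by apply: nneseries_ge0 => n n1 _; exact: rhs_ge0.
have partial_le := nneseries_lim_ge N.+1 (fun n n1 _ => rhs_ge0 n n1).
have C0' : (0 <= (((p + 1) / p) `^ q)%:E)%E by rewrite lee_fin ltW.
apply: le_trans (lee_wpmul2l C0' (partial_le xpredT)).
have mean_gt0 n : (1 <= n)%N -> 0 < wsum lambda a n / Lam lambda n.
  by case: n => // n _; apply: meanS_gt0.
rewrite (_ : (\sum_(1 <= n < N.+1) _)%R = (\sum_(1 <= n < N.+1)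
    lambda n * (wsum lambda a n / Lam lambda n) `^ (- p))%:E); last first.
  rewrite -sumEFin; apply: eq_big_nat => n /andP[n1 _].
  by rewrite epow_gt0E ?mean_gt0.
rewrite (_ : (\sum_(1 <= n < N.+1) _ * epow (a _) _)%E = (\sum_(1 <= n < N.+1)
    lambda n * (wsum lambda a n / Lam lambda n) `^ (- p + q)
      * a n `^ (- q))%:E); last first.
  rewrite -sumEFin; apply: eq_big_nat => n /andP[n1 _].
  by rewrite !epow_gt0E ?mean_gt0 ?a_gt0.
rewrite -EFinM lee_fin.
apply: le_trans (hardy_partial_sum _ _ _ _ _ N hlambda a_gt0 p0 hq).
rewrite lerDl; apply: mulr_ge0; first by rewrite divr_ge0 //; lra.
by rewrite mulr_ge0 ?Lam_ge0 ?powR_ge0.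
Qed.
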